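(* Let $\mathcal H=(\mathcal V,\mathcal E)$ be a hypergraph with $|\mathcal E|=n$. Then $\omega_0(\mathcal H)\le \frac{n(n+1)}{2}$, and equality holds if and only if the elements of $\mathcal E$ are mutually disjoint.
   Context: A hypergraph is a pair $\mathcal H=(\mathcal V,\mathcal E)$ where $\mathcal V$ is a finite set (vertices) and $\mathcal E$ is a collection of (pairwise distinct) nonempty subsets of $\mathcal V$ (hyperedges). An edge-discriminator on $\mathcal H$ is a function $\lambda:\mathcal V\to\mathbb Z^{+}\cup\{0\}$ such that $\sum_{v\in E}\lambda(v)>0$ for every $E\in\mathcal E$, and $\sum_{v\in E}\lambda(v)\ne\sum_{v\in E'}\lambda(v)$ for every two distinct $E,E'\in\mathcal E$. Its weight is $\omega_\lambda(\mathcal V)=\sum_{v\in\mathcal V}\lambda(v)$. The quantity $\omega_0(\mathcal H)$ is the minimum of $\omega_\lambda(\mathcal V)$ over all edge-discriminators $\lambda$ on $\mathcal H$. *)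

(* Defs.v *)
From HB Require Import structures.
From mathcomp Require Import all_boot.
From mathcomp Require Import boolp.

Set Implicit Arguments.
Unset Strict Implicit.
Unset Printing Implicit Defensive.

Record hypergraph := Hypergraph {
  vertices : finType;
  hyperedges : {set {set vertices}};
  hyperedges_nonempty : set0 \notin hyperedges }.

Definition edge_discriminator (H : hypergraph) (lam : vertices H -> nat) : Prop :=
  (forall A : {set vertices H}, A \in hyperedges H -> 0 < \sum_(v in A) lam v) /\
  (forall A B : {set vertices H},
     A \in hyperedges H -> B \in hyperedges H -> A != B ->
     \sum_(v in A) lam v <> \sum_(v in B) lam v).

Definition weight (H : hypergraph) (lam : vertices H -> nat) : nat :=
  \sum_(v : vertices H) lam v.

Definition discriminator_weight (H : hypergraph) (w : nat) : Prop :=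
  exists2 lam : vertices H -> nat, edge_discriminator lam & weight lam = w.

Lemma injective_subset_sums (T : finType) :
  exists lam : T -> nat, injective (fun A : {set T} => \sum_(v in A) lam v).
Proof.
suff [lam lamP] : exists lam : T -> nat, forall A B : {set T},
    \sum_(v <- enum T | v \in A) lam v = \sum_(v <- enum T | v \in B) lam v ->
    {in enum T, A =i B}.
  have sumE (C : {set T}) :
      \sum_(v in C) lam v = \sum_(v <- enum T | v \in C) lam v.
    by rewrite big_enum_cond.
  exists lam => A B; rewrite /= !sumE => /lamP AB.
  by apply/setP => v; apply: AB; rewrite mem_enum.
elim: (enum T) (enum_uniq T) => [_|v s IHs /= /andP[vs /IHs[lam lamP]]].
  by exists (fun=> 0).
exists (fun u => if u == v then 1 else (lam u).*2) => A B.
have sumE (C : {set T}) :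
    \sum_(u <- v :: s | u \in C) (if u == v then 1 else (lam u).*2) =
    (v \in C) + (\sum_(u <- s | u \in C) lam u).*2.
  rewrite big_cons eqxx (_ : \sum_(u <- s | _) _ = (\sum_(u <- s | u \in C) lam u).*2).
    by case: (v \in C).
  rewrite -muln2 big_distrl /= big_seq_cond [RHS]big_seq_cond.
  apply: eq_bigr => u /andP[us _]; rewrite muln2.
  by case: eqP us vs => // -> ->.
rewrite !sumE => eqAB.
have vAB : (v \in A) = (v \in B).
  by move/(congr1 odd): (eqAB); rewrite !oddD !odd_double !addbF !oddb.
move: eqAB; rewrite vAB => /addnI /double_inj /lamP AB u.
by rewrite inE => /predU1P[->|/AB].
Qed.

Lemma discriminator_weight_exists (H : hypergraph) :
  exists w, `[< discriminator_weight H w >].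
Proof.
have [lam lam_inj] := injective_subset_sums (vertices H).
exists (weight lam); apply/asboolP; exists lam => //; split=> [A AH|A B _ _ /eqP AB].
  rewrite lt0n; apply/eqP => A0; have /negP := hyperedges_nonempty H; apply.
  by rewrite -(_ : A = set0) //; apply: lam_inj; rewrite A0 big_set0.
by move/lam_inj.
Qed.

Definition omega0 (H : hypergraph) : nat := ex_minn (discriminator_weight_exists H).

Lemma omega0_attained (H : hypergraph) : discriminator_weight H (omega0 H).
Proof. by rewrite /omega0; case: ex_minnP => w /asboolP. Qed.

Lemma omega0_le (H : hypergraph) (lam : vertices H -> nat) :
  edge_discriminator lam -> omega0 H <= weight lam.
Proof.
rewrite /omega0; case: ex_minnP => w _ wmin lamP.
by apply: wmin; apply/asboolP; exists lam.
Qed.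

(* Main.v *)
Require Import Defs.
From mathcomp Require Import all_boot.
From mathcomp Require Import zify.

Set Implicit Arguments.
Unset Strict Implicit.
Unset Printing Implicit Defensive.

(** Add the empty set to the hyperedges, so that lam is an edge-discriminator
    exactly when the sums over these n + 1 sets are distinct, and set the vertex
    weights one at a time. When the weight of v is set, each pair of sets for
    which v is the last vertex in the symmetric difference forbids at most one
    value, so a value at most the number of such pairs is available; the total
    is at most 'C(n + 1, 2). If v lies in two hyperedges A and B, treat v last:
    the pairs (set0, A) and (set0, B) can then both forbid only the value 0,
    which saves one. Conversely, if the hyperedges are disjoint, the weight is
    at least a sum of n distinct positive integers. *)

(** Pigeonhole on the candidates from [0] to [size (undup s)]. Counting distinct entries, rather
    than all of [s], is what later yields a strict bound when two entries coincide. *)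
Lemma exists_le_size_undup_notin (s : seq nat) :
  exists2 k, k <= size (undup s) & k \notin s.
Proof.
case: (boolP (all (mem s) (iota 0 (size (undup s)).+1))) => [/allP sub|/allPn[k]].
  have := @uniq_leq_size _ (iota 0 (size (undup s)).+1) (undup s) (iota_uniq _ _).
  rewrite size_iota ltnn => /(_ _)/negP; case=> //.
  by move=> k /sub; rewrite mem_undup.
by rewrite mem_iota => /andP[_ k_le] ks; exists k.
Qed.

(** Among n + 1 distinct naturals one is at least n, since only n naturals lie below n; remove it
    and induct. *)
Lemma bin2_size_le_sum (s : seq nat) : uniq s -> 'C(size s, 2) <= \sum_(x <- s) x.
Proof.
move: {-1}(size s) (erefl (size s)) => n; elim: n s => [|n IHn] s sz us.
  by rewrite bin0n.
have [x xs nx] : exists2 x, x \in s & n <= x.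
  case: (boolP (all (mem (iota 0 n)) s)) => [/allP sub|/allPn[x xs]].
    by have := uniq_leq_size us sub; rewrite sz size_iota ltnn.
  by rewrite /= mem_iota add0n -leqNgt; exists x.
rewrite (perm_big _ (perm_to_rem xs)) /= big_cons binS bin1 addnC leq_add //.
by apply: IHn; rewrite ?rem_uniq // size_rem // sz.
Qed.

Fixpoint ordered_pairs (T : Type) (s : seq T) : seq (T * T) :=
  if s is x :: s' then [seq (x, y) | y <- s'] ++ ordered_pairs s' else [::].

Lemma size_ordered_pairs (T : Type) (s : seq T) :
  size (ordered_pairs s) = 'C(size s, 2).
Proof.
by elim: s => //= x s IHs; rewrite size_cat size_map IHs binS bin1 addnC.
Qed.

Lemma mem_ordered_pairs (T : eqType) (s : seq T) (x y : T) :
  x \in s -> y \in s -> x != y ->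
  (x, y) \in ordered_pairs s \/ (y, x) \in ordered_pairs s.
Proof.
elim: s => //= z s IHs; rewrite !inE !mem_cat.
move=> /predU1P[->|xs] /predU1P[->|ys] xy; first by rewrite eqxx in xy.
- by left; rewrite map_f.
- by right; rewrite map_f.
- by have [->|->] := IHs xs ys xy; rewrite orbT; [left|right].
Qed.

Lemma ordered_pairs_neq (T : eqType) (s : seq T) (p : T * T) :
  uniq s -> p \in ordered_pairs s -> p.1 != p.2.
Proof.
elim: s => //= x s IHs /andP[xs us]; rewrite mem_cat => /orP[/mapP[y ys ->]|].
  by apply: contraNneq xs => /= ->.
exact: IHs.
Qed.

Section Separation.

Variable T : finType.
Implicit Types (lam : T -> nat) (p : {set T} * {set T}) (P : seq ({set T} * {set T})).

Definition separates lam p := \sum_(u in p.1) lam u != \sum_(u in p.2) lam u.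

Definition differs_at v p := (v \in p.1) != (v \in p.2).

(* The only value whose addition to [lam v] can equate the two sums, when [p]
   differs at [v]; truncated to [0] when no value can. *)
Definition forbidden lam v p :=
  if v \in p.1 then \sum_(u in p.2) lam u - \sum_(u in p.1) lam u
  else \sum_(u in p.1) lam u - \sum_(u in p.2) lam u.

(** Only the weight of [v] changes. A pair that does not differ at [v] gains the same amount on both
    sides, so it stays separated; the others only need the increment to avoid their forbidden
    values. *)
Lemma extend_separation lam v P :
  {in P, forall p, ~~ differs_at v p -> separates lam p} ->
  exists2 mu, {in P, forall p, separates mu p} &
    \sum_u mu u <=
      \sum_u lam u + size (undup (map (forbidden lam v) (filter (differs_at v) P))).
Proof.
move=> sep.
have [k k_le kP] :=
  exists_le_size_undup_notin (map (forbidden lam v) (filter (differs_at v) P)).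
pose mu u := lam u + (if u == v then k else 0).
have muE (A : {set T}) :
    \sum_(u in A) mu u = \sum_(u in A) lam u + (if v \in A then k else 0).
  rewrite big_split /= -big_mkcondr /=; congr (_ + _).
  case: ifP => vA; last first.
    by rewrite big_pred0 // => u; case: eqP => [->|]; rewrite ?vA ?andbF.
  by rewrite (big_pred1 v) // => u /=; case: eqP => [->|]; rewrite ?vA ?andbF.
exists mu => [p pP|]; last first.
  (* Taking the sum over [setT] shows that the total weight grows by exactly [k]. *)
  have := muE setT; rewrite inE; under eq_bigl do rewrite inE.
  by under [X in X + _]eq_bigl do rewrite inE; move=> ->; rewrite leq_add2l.
have [pv|pv] := boolP (differs_at v p); last first.
  have := sep p pP pv; rewrite /separates !muE.
  by move: pv; rewrite negbK => /eqP ->; rewrite eqn_add2r.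
have : forbidden lam v p != k.
  by apply: contraNneq kP => <-; rewrite map_f // mem_filter pv.
move: pv; rewrite /separates /forbidden /differs_at !muE.
by case: (v \in p.1); case: (v \in p.2) => //= _; lia.
Qed.

Lemma exists_separating P :
  {in P, forall p, p.1 != p.2} ->
  exists2 lam, {in P, forall p, separates lam p} & \sum_u lam u <= size P.
Proof.
move=> neqP.
have {neqP} : {in P, forall p, has (differs_at^~ p) (enum T)}.
  move=> p /neqP; apply: contraR => /hasPn same.
  apply/eqP/setP => v; apply/eqP.
  by have := same v (mem_enum _ _); rewrite negbK.
(* The invariant is that each pair of [P] differs at some vertex of the list. Pairs differing at the
   head [v] are set aside for the inductive call and charged to [v], whose weight is set afterwards;
   thus each pair is counted once. *)
elim: (enum T) P => [|v s IHs] P diffP.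
  by exists (fun=> 0) => [p /diffP //|]; rewrite big1.
have [|lam sep lam_le] := IHs (filter (predC (differs_at v)) P).
  move=> p; rewrite mem_filter => /andP[/= pv /diffP /=].
  by rewrite (negbTE pv).
have [|mu mu_sep mu_le] := @extend_separation lam v P.
  by move=> p pP pv; apply: sep; rewrite mem_filter /= pv.
exists mu => //; apply: (leq_trans mu_le).
rewrite -(count_predC (differs_at v) P) addnC leq_add -?size_filter //.
by rewrite (leq_trans (size_undup _)) // size_map.
Qed.

Lemma exists_separating_lt P v (A B : {set T}) :
  {in P, forall p, p.1 != p.2} -> (set0, A) \in P -> (set0, B) \in P ->
  A != B -> v \in A -> v \in B ->
  exists2 lam, {in P, forall p, separates lam p} & \sum_u lam u < size P.
Proof.
move=> neqP AP BP AB vA vB.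
have [|lam sep lam_le] := @exists_separating (filter (predC (differs_at v)) P).
  by move=> p; rewrite mem_filter => /andP[_ /neqP].
have [|mu mu_sep mu_le] := @extend_separation lam v P.
  by move=> p pP pv; apply: sep; rewrite mem_filter /= pv.
exists mu => //; apply: (leq_ltn_trans mu_le).
rewrite -(count_predC (differs_at v) P) addnC -!size_filter.
(* Strictness reduces to a repetition among the values forbidden at [v]. *)
rewrite -addSn leq_add // -(size_map (forbidden lam v)) ltn_size_undup.
(* Here [v] is not in [set0], so the truncated difference starts from an empty sum. *)
have forb0 C : forbidden lam v (set0, C) = 0.
  by rewrite /forbidden /= inE big_set0 sub0n.
set Q := filter _ P.
have AQ : (set0, A) \in Q by rewrite mem_filter AP andbT /differs_at inE vA.
have BQ : (set0, B) \in Q by rewrite mem_filter BP andbT /differs_at inE vB.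
(* After [(set0, A)] is removed from [Q], its value [0] still occurs, coming from [(set0, B)]. *)
rewrite (perm_uniq (perm_map _ (perm_to_rem AQ))) /= negb_and negbK.
rewrite forb0 -(forb0 B) map_f //.
have := BQ; rewrite (perm_mem (perm_to_rem AQ)) inE => /predU1P[[BA]|//].
by rewrite BA eqxx in AB.
Qed.

End Separation.

Section EdgeDiscriminators.

Variable H : hypergraph.

(** Putting [set0] first fixes the orientation [(set0, A)], on which the strict bound relies. *)
Let edge_pairs := ordered_pairs (set0 :: enum (hyperedges H)).

Lemma uniq_edges0 : uniq (set0 :: enum (hyperedges H)).
Proof. by rewrite /= enum_uniq mem_enum (hyperedges_nonempty H). Qed.

Lemma size_edge_pairs : size edge_pairs = 'C(#|hyperedges H|.+1, 2).
Proof. by rewrite size_ordered_pairs /= cardE. Qed.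

Lemma edge_pairs0 (A : {set vertices H}) :
  A \in hyperedges H -> (set0, A) \in edge_pairs.
Proof.
by move=> AH; rewrite /edge_pairs /= mem_cat map_f // mem_enum.
Qed.

Lemma edge_discriminator_separates (lam : vertices H -> nat) :
  {in edge_pairs, forall p, separates lam p} -> edge_discriminator lam.
Proof.
move=> sep; split=> [A /edge_pairs0/sep|A B AH BH AB].
  by rewrite /separates big_set0 eq_sym lt0n.
have [||/sep|/sep] := mem_ordered_pairs (s := set0 :: enum (hyperedges H)) _ _ AB.
- by rewrite inE mem_enum AH orbT.
- by rewrite inE mem_enum BH orbT.
- by move/eqP.
- by move/eqP=> /= neq /esym.
Qed.

Lemma omega0_le_bin : omega0 H <= 'C(#|hyperedges H|.+1, 2).
Proof.
have [|lam sep lam_le] := @exists_separating _ edge_pairs.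
  by move=> p; apply: ordered_pairs_neq uniq_edges0.
by rewrite (leq_trans (omega0_le (edge_discriminator_separates sep))) // -size_edge_pairs.
Qed.

Lemma omega0_lt_bin (A B : {set vertices H}) :
  A \in hyperedges H -> B \in hyperedges H -> A != B -> ~~ [disjoint A & B] ->
  omega0 H < 'C(#|hyperedges H|.+1, 2).
Proof.
move=> AH BH AB /pred0Pn[v /andP[/= vA vB]].
have [|lam sep lam_lt] :=
  exists_separating_lt (P := edge_pairs) _ (edge_pairs0 AH) (edge_pairs0 BH) AB vA vB.
  by move=> p; apply: ordered_pairs_neq uniq_edges0.
by rewrite (leq_ltn_trans (omega0_le (edge_discriminator_separates sep))) // -size_edge_pairs.
Qed.

Lemma bin_le_omega0 : trivIset (hyperedges H) -> 'C(#|hyperedges H|.+1, 2) <= omega0 H.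
Proof.
move=> disj; have [lam [pos neq] <-] := omega0_attained H.
pose w (A : {set vertices H}) := \sum_(v in A) lam v.
(* Positivity allows [0] to join the n edge sums, giving n + 1 distinct naturals. *)
have us : uniq (0 :: map w (enum (hyperedges H))).
  rewrite /= map_inj_in_uniq ?enum_uniq ?andbT; last first.
    move=> A B; rewrite !mem_enum => AH BH eqw.
    by apply/eqP/negPn/negP => /(neq _ _ AH BH).
  apply/mapP => -[A]; rewrite mem_enum => /pos + w0.
  by rewrite -/(w A) -w0.
have := bin2_size_le_sum us; rewrite /= size_map -cardE.
move/leq_trans; apply; rewrite big_cons add0n big_map big_enum /=.
(* By disjointness the edge sums add up to the weight of the cover; vertices outside it only add to
   the total. *)
rewrite /w -(big_trivIset _ disj) /= /weight.
by rewrite [leqRHS](bigID (mem (cover (hyperedges H)))) /= leq_addr.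
Qed.

End EdgeDiscriminators.

Theorem theorem1p1 (H : hypergraph) (n : nat) (hn : #|hyperedges H| = n) :
  omega0 H <= (n * (n + 1)) %/ 2 /\
  (omega0 H = (n * (n + 1)) %/ 2 <->
   forall A B : {set vertices H},
     A \in hyperedges H -> B \in hyperedges H -> A != B -> [disjoint A & B]).
Proof.
have -> : (n * (n + 1)) %/ 2 = 'C(#|hyperedges H|.+1, 2).
  by rewrite hn bin2 divn2 addn1 mulnC.
split; first exact: omega0_le_bin.
split=> [eqw A B AH BH AB|disj].
  apply/negPn/negP => /(omega0_lt_bin AH BH AB).
  by rewrite eqw ltnn.
apply/eqP; rewrite eqn_leq omega0_le_bin bin_le_omega0 //.
by apply/trivIsetP => A B AH BH AB; apply: disj.
Qed.
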